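(* Let $\Gamma$ be a strictly Deza graph with parameters $(n,k,b,a)$ and $\beta(\Gamma)>1$. Then $k=b+1$ if and only if $\Gamma$ is isomorphic to the $2$-clique extension of the complete multipartite graph with parts of size $\frac{n-k+1}{2}$.
   Context: All graphs are finite, undirected, without loops or multiple edges. For a vertex $v$, $N(v)$ is its set of neighbours. A nonempty $k$-regular graph $\Gamma$ on $n$ vertices is a Deza graph with parameters $(n,k,b,a)$, $b\ge a$, if every pair of distinct vertices has either exactly $b$ or exactly $a$ common neighbours. A strictly Deza graph is a Deza graph of diameter $2$ that is not strongly regular. For a vertex $v$, $B(v)$ is the set of vertices $u$ with $|N(v)\cap N(u)|=b$; for a strictly Deza graph $|B(v)|$ does not depend on $v$ and is denoted $\beta(\Gamma)$. For graphs $\Delta_1,\Delta_2$, the extension (composition) of $\Delta_1$ by $\Delta_2$ has vertex set $V(\Delta_1)\times V(\Delta_2)$, with $(v_1,v_2)$ adjacent to $(u_1,u_2)$ iff either $v_1u_1$ is an edge of $\Delta_1$, or $v_1=u_1$ and $v_2u_2$ is an edge of $\Delta_2$. The $m$-clique extension of $\Delta_1$ is its extension by the complete graph $K_m$. *)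

(* Defs.v *)
From mathcomp Require Import all_boot.

Set Implicit Arguments.
Unset Strict Implicit.
Unset Printing Implicit Defensive.

Record sgraph := SGraph {
  vertex :> finType;
  adj : rel vertex;
  adj_sym : symmetric adj;
  adj_irr : irreflexive adj
}.

Definition isomorphic (G H : sgraph) : Prop :=
  exists f : G -> H, bijective f /\ forall x y, adj (f x) (f y) = adj x y.

Definition nbhd (G : sgraph) (v : G) : {set G} := [set u | adj v u].

Definition common (G : sgraph) (u v : G) : nat := #|nbhd u :&: nbhd v|.

Definition regular (G : sgraph) (k : nat) : Prop :=
  forall v : G, #|nbhd v| = k.

(* [p] is the list of vertices after [x] on a walk. *)
Definition is_dist (G : sgraph) (x y : G) (d : nat) : Prop :=
  (exists p : seq G, [/\ path (@adj G) x p, last x p = y & size p = d]) /\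
  (forall p : seq G, path (@adj G) x p -> last x p = y -> d <= size p).

Definition has_diameter (G : sgraph) (D : nat) : Prop :=
  (forall x y : G, exists2 d, is_dist x y d & d <= D) /\
  (exists x y : G, is_dist x y D).

Definition srg (G : sgraph) (n k l m : nat) : Prop :=
  [/\ #|G| = n,
      regular G k,
      forall u v : G, adj u v -> common u v = l &
      forall u v : G, u != v -> ~~ adj u v -> common u v = m].

(* Complete and edgeless graphs are allowed here, and [n > 0] is the only
   nonemptiness required below; in [strictly_deza] diameter 2 rules out the
   degenerate cases, so that these conventions have no effect there. *)
Definition strongly_regular (G : sgraph) : Prop :=
  exists n k l m, srg G n k l m.

Definition deza (G : sgraph) (n k b a : nat) : Prop :=
  [/\ #|G| = n /\ 0 < n,
      regular G k,
      a <= b &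
      forall u v : G, u != v -> common u v = b \/ common u v = a].

Definition strictly_deza (G : sgraph) (n k b a : nat) : Prop :=
  [/\ deza G n k b a, has_diameter G 2 & ~ strongly_regular G].

Definition Bset (G : sgraph) (b : nat) (v : G) : {set G} :=
  [set u | common v u == b].

(* The common value of the [#|Bset b v|]: see [card_Bset] below. *)
Definition beta (G : sgraph) (b : nat) : nat := \max_(v : G) #|Bset b v|.

Section Extension.
Variables D1 D2 : sgraph.

Definition ext_adj : rel (D1 * D2) :=
  [rel x y | adj x.1 y.1 || (x.1 == y.1) && adj x.2 y.2].

Fact ext_adj_sym : symmetric ext_adj.
Proof.
by move=> x y; rewrite /ext_adj /= adj_sym eq_sym [in X in _ || X]adj_sym.
Qed.

Fact ext_adj_irr : irreflexive ext_adj.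
Proof. by move=> x; rewrite /ext_adj /= !adj_irr andbF. Qed.

Definition extension : sgraph := SGraph ext_adj_sym ext_adj_irr.
End Extension.

Section Complete.
Variable m : nat.

Definition complete_adj : rel 'I_m := [rel x y | x != y].

Fact complete_adj_sym : symmetric complete_adj.
Proof. by move=> x y; rewrite /complete_adj /= eq_sym. Qed.

Fact complete_adj_irr : irreflexive complete_adj.
Proof. by move=> x; rewrite /complete_adj /= eqxx. Qed.

Definition complete_graph : sgraph := SGraph complete_adj_sym complete_adj_irr.
End Complete.

Definition clique_extension (m : nat) (D : sgraph) : sgraph :=
  extension D (complete_graph m).

Section Multipartite.
Variables t s : nat.

(* Vertex [(i, j)] is the [j]-th vertex of the [i]-th part. *)
Definition multipartite_adj : rel ('I_t * 'I_s) := [rel x y | x.1 != y.1].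

Fact multipartite_adj_sym : symmetric multipartite_adj.
Proof. by move=> x y; rewrite /multipartite_adj /= eq_sym. Qed.

Fact multipartite_adj_irr : irreflexive multipartite_adj.
Proof. by move=> x; rewrite /multipartite_adj /= eqxx. Qed.

Definition complete_multipartite : sgraph :=
  SGraph multipartite_adj_sym multipartite_adj_irr.
End Multipartite.

Lemma sum_common (G : sgraph) (k : nat) (v : G) :
  regular G k -> \sum_(u : G) common v u = k * k.
Proof.
move=> regG.
have E (u : G) : common v u = \sum_(w in nbhd v) (adj w u : nat).
  rewrite /common -sum1_card big_mkcond [RHS]big_mkcond /=.
  apply: eq_bigr => w _; rewrite !inE adj_sym [adj u w]adj_sym.
  by case: (adj w v); case: (adj w u).
rewrite (eq_bigr _ (fun u _ => E u)) exchange_big /=.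
rewrite (eq_bigr (fun=> k)) => [|w _]; first by rewrite sum_nat_const regG.
rewrite -(regG w) -sum1_card [RHS]big_mkcond /=.
by apply: eq_bigr => u _; rewrite inE; case: (adj w u).
Qed.

Lemma strictly_deza_lt (G : sgraph) n k b a :
  strictly_deza G n k b a -> a < b.
Proof.
case=> -[[nG _] regG leab dezG] _ nsrg; rewrite ltn_neqAle leab andbT.
apply/eqP => eab; apply: nsrg; exists n, k, b, b; split=> // u v => [uv|uv _].
  have {uv}/dezG : u != v by apply: contraTneq uv => ->; rewrite adj_irr.
  by rewrite eab => -[].
by have := dezG _ _ uv; rewrite eab => -[].
Qed.

Lemma card_Bset (G : sgraph) n k b a (v : G) :
  strictly_deza G n k b a -> #|Bset b v| = beta G b.
Proof.
move=> sG; have ltab := strictly_deza_lt sG.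
case: sG => -[_ regG _ dezG] _ _.
have cE (x : G) : #|Bset b x| = (k == b) + #|Bset b x :\ x|.
  by rewrite (cardsD1 x) inE /common setIid regG.
have B1 (x : G) :
    k * k = k + ((b - a) * #|Bset b x :\ x| + a * #|G|.-1).
  rewrite -(sum_common x regG) (bigD1 x) //= {1}/common setIid regG.
  congr (_ + _).
  rewrite -(cardC1 x) mulnC -sum_nat_const mulnC -sum_nat_const.
  rewrite [X in X + _]big_mkcond [X in _ + X]big_mkcond -big_split /=.
  rewrite big_mkcond; apply: eq_bigr => u _; rewrite !inE.
  have [->|nux] //= := eqVneq u x.
  have [->|nb] := eqVneq (common x u) b; first by rewrite subnK // ltnW.
  have /dezG : x != u by rewrite eq_sym.
  by case=> [e|->//]; rewrite e eqxx in nb.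
have C (x : G) : #|Bset b x| = #|Bset b v|.
  rewrite !cE; congr (_ + _).
  move: (B1 x); rewrite (B1 v) => /eqP; rewrite eqn_add2l eqn_add2r.
  by rewrite eqn_pmul2l ?subn_gt0 // => /eqP ->.
apply/eqP; rewrite eqn_leq /beta leq_bigmax /=.
by apply/bigmax_leqP => x _; rewrite C.
Qed.

(* Main.v *)
(* Let k = b + 1. If a = b - 1, counting gives beta = 2 - (n - k - 2)(k - 2),
   which forces n = k + 2 or k = 2, both impossible.

   Let a <= b - 2. Two vertices with b common neighbours have neighbourhoods
   that differ by the exchange of one vertex, so their numbers of common
   neighbours with a third vertex differ by at most 1, hence not at all. So
   being equal or having b common neighbours is an equivalence; its classes have
   size m = beta + 1 >= 3. Each vertex u has exactly one class P(u) on
   which adjacency to u is not constant, u has 1 or m - 1 neighbours in P(u),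
   and v in P(u) iff u in P(v). Counting modulo m, k is 1 or -1, and for u, w
   in different classes
     a = k ([w is adjacent to P(u)] + [u is adjacent to P(w)])  (mod m).
   If u is not in P(u), a non-neighbour y of u in P(u) yields a = 0 (mod m), so
   that all neighbours of y lie in the class of u and none of them is adjacent
   to u, against diameter 2. So u is in P(u), a = 2k [u adjacent to w] (mod m),
   and distinct classes are either all joined or all separated. The former holds
   by connectedness, and then the m - 1 alternative is a complete graph: the
   classes induce perfect matchings.

   Conversely, every vertex of a 2-clique extension has an adjacent twin, which
   gives a pair with k - 1 common neighbours and excludes distinct vertices with
   k common neighbours. *)
Require Import Defs.
From mathcomp Require Import all_boot zify.

Set Implicit Arguments.
Unset Strict Implicit.
Unset Printing Implicit Defensive.

(** * Diameter 2 and unions of classes *)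

Lemma commonC (G : sgraph) (u v : G) : common u v = common v u.
Proof. by rewrite /common setIC. Qed.

Lemma card_nbhdD (G : sgraph) k (u v : G) :
  regular G k -> #|nbhd u :\: nbhd v| = k - common u v.
Proof. by move=> regG; rewrite cardsD regG. Qed.

Lemma nbhd_subset_nonadj (G : sgraph) (u v : G) :
  ~~ adj u v -> nbhd u \subset ~: [set u; v].
Proof.
move=> nuv; apply/subsetP=> z; rewrite !inE.
by apply: contraL => /orP[]/eqP->; rewrite ?adj_irr.
Qed.

Lemma diameter2_common (G : sgraph) (u v : G) :
  has_diameter G 2 -> u != v -> ~~ adj u v -> exists2 w, adj u w & adj w v.
Proof.
case=> diam _ uv nuv; have [d [[p [up lastp sizep]] _] led] := diam u v.
case: p up lastp sizep => [|x [|y [|z p]]] /=; last by move=> _ _ /= ed; lia.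
- by move=> _ /eqP; rewrite (negbTE uv).
- by rewrite andbT => ux xv _; rewrite xv (negbTE nuv) in ux.
- by case/and3P=> ux xy _ <- _; exists x.
Qed.

Lemma diameter2_nonadj (G : sgraph) :
  has_diameter G 2 -> exists u v : G, u != v /\ ~~ adj u v.
Proof.
case=> _ [u [v [_ short]]]; exists u, v; split.
- by apply/eqP=> uv; have := short [::] isT uv.
- by apply/negP=> uv; have := short [:: v]; rewrite /= uv => /(_ isT erefl).
Qed.

Lemma dvdn_card_closed (T : finType) (R : rel T) m (S : {set T}) :
    equivalence_rel R -> (forall x, #|[set y | R x y]| = m) ->
    (forall x y, R x y -> x \in S -> y \in S) ->
  m %| #|S|.
Proof.
move=> eqR cardR closedS.
have eqRS : {in S & &, equivalence_rel R} by move=> x y z _ _ _; apply: eqR.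
rewrite (card_uniform_partition (n := m) _ (equivalence_partitionP eqRS)).
  exact: dvdn_mull.
move=> _ /imsetP[x Sx ->]; rewrite -(cardR x); apply: eq_card => y.
by rewrite !inE andb_idl // => /closedS; apply.
Qed.

(** * Exchanges of one neighbour *)

Section Swaps.
Variables (G : sgraph) (b : nat).
Hypothesis regG : regular G b.+1.
Implicit Types u v w x y p q : G.

(* The neighbourhood of [v] arises from that of [u] by replacing [p] by [q];
   when [u] and [v] are adjacent, [p = v] and [q = u]. *)
Definition swap u v p q :=
  nbhd u :\: nbhd v = [set p] /\ nbhd v :\: nbhd u = [set q].

Lemma swapE u v p q : swap u v p q ->
  (forall x, adj u x && ~~ adj v x = (x == p)) /\
  (forall x, adj v x && ~~ adj u x = (x == q)).
Proof.
by case=> /setP up /setP vq; split=> x; [have := up x | have := vq x];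
   rewrite !inE andbC.
Qed.

Lemma swap_mem u v p q : swap u v p q ->
  [/\ adj u p, ~~ adj v p, adj v q & ~~ adj u q].
Proof.
case/swapE=> up vq; have /andP[-> ->] : adj u p && ~~ adj v p by rewrite up.
by have /andP[-> ->] : adj v q && ~~ adj u q by rewrite vq.
Qed.

Lemma swapC u v p q : swap u v p q -> swap v u q p.
Proof. by case=> up vq; split. Qed.

Lemma swap_common u v p q : swap u v p q -> common u v = b.
Proof.
case=> /(congr1 (fun A : {set G} => #|A|)).
rewrite (card_nbhdD _ _ regG) cards1; lia.
Qed.

Lemma common_swap u v : common u v = b -> exists p q, swap u v p q.
Proof.
move=> cuv.
have /cards1P[p up] : #|nbhd u :\: nbhd v| == 1.
  by rewrite (card_nbhdD _ _ regG) cuv subSnn.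
have /cards1P[q vq] : #|nbhd v :\: nbhd u| == 1.
  by rewrite (card_nbhdD _ _ regG) commonC cuv subSnn.
by exists p, q.
Qed.

(** Both sides count the neighbours of [w] in the union of [nbhd u] and [nbhd v]. *)
Lemma swap_commonD u v p q w : swap u v p q ->
  common w u + adj w q = common w v + adj w p.
Proof.
have card1 (x : G) : #|nbhd w :&: [set x]| = adj w x.
  rewrite setIC -sum1_card (eq_bigl _ _ (fun z => in_setI z _ _)).
  rewrite big_mkcondr (eq_bigl _ _ (fun z => in_set1 z _)) big_pred1_eq inE.
  by case: (adj w x).
case=> up vq; rewrite -!card1 -up -vq /common.
rewrite -(cardsID (nbhd v) (nbhd w :&: nbhd u)).
rewrite -(cardsID (nbhd u) (nbhd w :&: nbhd v)) !setIDA.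
by rewrite -!setIA [nbhd v :&: nbhd u]setIC; lia.
Qed.

Section Gap.
Variable a : nat.
Hypothesis gap : a.+1 < b.
Hypothesis dezG : forall u v, u != v -> common u v = b \/ common u v = a.

(** By [swap_commonD] the two numbers differ by at most 1, while [a] and [b] differ by at least
    2. *)
Lemma swap_common_eq u v p q w :
  swap u v p q -> w != u -> w != v -> common w u = common w v.
Proof.
move=> sw /dezG wu /dezG wv; have := swap_commonD w sw.
by case: wu wv => -> [] ->; case: (adj w p); case: (adj w q) => /=; lia.
Qed.

(** For [x] other than [u] and [v], [swap_common_eq] reduces [swap_commonD] to
    [adj x p = adj x q]. *)
Lemma swap_sym u v p q : swap u v p q -> swap p q u v.
Proof.
have half u0 v0 p0 q0 : swap u0 v0 p0 q0 -> nbhd p0 :\: nbhd q0 = [set u0].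
  move=> sw; have [up vp vq uq] := swap_mem sw.
  apply/setP=> x; rewrite !inE ![adj _ x]adj_sym.
  have [->|xu] := eqVneq x u0; first by rewrite up uq.
  have [->|xv] := eqVneq x v0; first by rewrite (negbTE vp) andbF.
  have := swap_commonD x sw; rewrite (swap_common_eq sw xu xv).
  by case: (adj x p0); case: (adj x q0) => /=; lia.
by move=> sw; split; [apply: half sw | apply: half (swapC sw)].
Qed.

(** The first disjunct gives reflexivity: a vertex has [b.+1] common neighbours with itself. *)
Definition close u v := (u == v) || (common u v == b).

Lemma close_swap u v : u != v -> close u v -> exists p q, swap u v p q.
Proof. by rewrite /close => /negbTE-> /eqP/common_swap. Qed.

Lemma swap_close u v p q : swap u v p q -> close u v.
Proof. by move/swap_common=> cuv; rewrite /close cuv eqxx orbT. Qed.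

Lemma closexx u : close u u. Proof. by rewrite /close eqxx. Qed.

Lemma closeC u v : close u v = close v u.
Proof. by rewrite /close eq_sym commonC. Qed.

Lemma close_trans v u w : close u v -> close v w -> close u w.
Proof.
have [->//|uv] := eqVneq u v; have [<-//|vw] := eqVneq v w.
have [->|uw] := eqVneq u w; first by rewrite closexx.
move=> /(close_swap uv)[p [q sw]].
have wu : w != u by rewrite eq_sym.
have wv : w != v by rewrite eq_sym.
rewrite closeC [close u w]closeC /close (negbTE wu) (negbTE wv) /=.
by rewrite (swap_common_eq sw).
Qed.

Lemma close_congr u v w : close u v -> close u w = close v w.
Proof.
by move=> uv; apply/idP/idP; apply: close_trans => //; rewrite closeC.
Qed.

Lemma close_equiv : equivalence_rel close.
Proof. by move=> x y z; split=> [|/close_congr//]; apply: closexx. Qed.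

(** * Classes on which adjacency is not constant *)

(** The only neighbour that [p] has and [q] lacks must be [x]; [swap_sym] reads this exchange from
    the side of [x]. *)
Lemma mixed_swap x p q :
  close p q -> adj x p -> ~~ adj x q -> exists y, swap x y p q.
Proof.
move=> pq xp xq; have npq : p != q by apply: contraNneq xq => <-.
have [r [s sw]] := close_swap npq pq; have [pr _] := swapE sw.
have /eqP rx : x == r by rewrite -pr ![adj _ x]adj_sym xp.
by exists s; rewrite rx; apply: swap_sym.
Qed.

(* Otherwise the vertices [y], [y'] for which [nbhd x] is changed by [p -> q]
   and [p' -> q'] would be close, while their neighbourhoods differ in the two
   vertices [p'] and [q] of [nbhd y]. *)
Lemma mixed_unique x p q p' q' :
    close p q -> adj x p -> ~~ adj x q ->
    close p' q' -> adj x p' -> ~~ adj x q' ->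
  p = p' \/ q = q'.
Proof.
move=> pq xp xq pq' xp' xq'.
have [->|npp] := eqVneq p p'; first by left.
have [->|nqq] := eqVneq q q'; first by right.
have [y sw] := mixed_swap pq xp xq; have [y' sw'] := mixed_swap pq' xp' xq'.
have [_ _ yq _] := swap_mem sw; have [_ y'p' _ _] := swap_mem sw'.
have [xyp _] := swapE sw; have [_ y'xq'] := swapE sw'.
have yp' : adj y p'.
  have := xyp p'; rewrite xp' /= [p' == p]eq_sym (negbTE npp).
  by move/negbT; rewrite negbK.
have y'q : ~~ adj y' q.
  by have := y'xq' q; rewrite xq andbT (negbTE nqq) => ->.
have nyy : y != y' by apply: contraNneq y'q => <-.
have cyy : close y y'.
  by apply: close_trans (swap_close sw'); rewrite closeC (swap_close sw).
have [r [s /swapE[yr _]]] := close_swap nyy cyy.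
have /eqP p'r : p' == r by rewrite -yr yp' y'p'.
have /eqP qr : q == r by rewrite -yr yq y'q.
by rewrite p'r -qr (negbTE xq) in xp'.
Qed.

(** This is P(x); that it is at most one class is [mixed_close]. *)
Definition mixed x : {set G} :=
  [set p | [exists q, close p q && (adj x p != adj x q)]].

Lemma mixedP x p : reflect
  (exists p' q, [/\ close p p', close p q, adj x p' & ~~ adj x q])
  (p \in mixed x).
Proof.
rewrite inE; apply: (iffP existsP) => [[q /andP[pq]]|[p' [q [pp' pq xp' xq]]]].
  case xp: (adj x p) => xq; [exists p, q | exists q, p]; rewrite closexx pq xp.
  - by split=> //; apply: contra xq => ->.
  - by split=> //; case: (adj x q) xq.
case xp: (adj x p); [exists q | exists p'].
- by rewrite pq (negbTE xq).
- by rewrite pp' xp'.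
Qed.

(** Any two exchanges at [x] share an end by [mixed_unique], so they lie in the same class. *)
Lemma mixed_close x p q : p \in mixed x -> (q \in mixed x) = close p q.
Proof.
move=> /mixedP[p1 [q1 [pp1 pq1 xp1 xq1]]].
apply/idP/idP=> [/mixedP[p2 [q2 [qp2 qq2 xp2 xq2]]]|pq]; last first.
  by apply/mixedP; exists p1, q1; rewrite -!(close_congr _ pq).
have c1 : close p1 q1 by rewrite -(close_congr _ pp1).
have c2 : close p2 q2 by rewrite -(close_congr _ qp2).
have [e|e] := mixed_unique c1 xp1 xq1 c2 xp2 xq2; subst.
- by apply: close_trans pp1 _; rewrite closeC.
- by apply: close_trans pq1 _; rewrite closeC.
Qed.

Lemma notin_mixed x p q : p \notin mixed x -> close p q -> adj x q = adj x p.
Proof.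
rewrite inE => /existsPn/(_ q) + pq; rewrite pq /=.
by rewrite negbK => /eqP.
Qed.

(** The vertex [y] given by [mixed_swap] is close to [x] and disagrees with [x] at both ends of the
    exchange. *)
Lemma mixed_sym x p : p \in mixed x -> x \in mixed p.
Proof.
rewrite inE => /existsP[q /andP[pq xpq]].
have mix p0 q0 : close p0 q0 -> adj x p0 -> ~~ adj x q0 ->
    x \in mixed p0 /\ x \in mixed q0.
  move=> pq0 xp xq; have [y sw] := mixed_swap pq0 xp xq.
  have [_ yp yq _] := swap_mem sw; have xy := swap_close sw.
  split; rewrite inE; apply/existsP; exists y; rewrite xy.
  - by rewrite ![adj _ x]adj_sym ![adj _ y]adj_sym xp (negbTE yp).
  - by rewrite ![adj _ x]adj_sym ![adj _ y]adj_sym yq (negbTE xq).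
case xp: (adj x p) xpq => xq.
- by have [] // := mix p q pq xp; apply: contra xq => ->.
- rewrite closeC in pq; have [] // := mix q p pq; last by rewrite xp.
  by case: (adj x q) xq.
Qed.

Lemma close_swap_mixed u v : u != v -> close u v -> exists p, p \in mixed u.
Proof.
move=> uv /(close_swap uv)[p [q sw]]; exists p; have [up _ _ uq] := swap_mem sw.
by apply/mixedP; exists p, q; rewrite closexx (swap_close (swap_sym sw)).
Qed.

(** Two neighbours and two non-neighbours of [x] in the class would give two disjoint exchanges,
    against [mixed_unique]. *)
Lemma card_nbhd_mixed x : mixed x != set0 ->
  #|nbhd x :&: mixed x| = 1 \/ #|mixed x :\: nbhd x| = 1.
Proof.
case/set0Pn=> p /[dup] px /mixedP[p1 [q1 [pp1 pq1 xp1 xq1]]].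
have [/existsP[p2 /and3P[]]|none] :=
    boolP [exists p2, [&& p2 != p1, adj x p2 & p2 \in mixed x]]; last first.
  left; apply/eqP/cards1P; exists p1; apply/setP=> z.
  rewrite in_setI in_set1 [z \in nbhd x]inE.
  have [->|zp1] := eqVneq z p1.
    by rewrite xp1 /= (mixed_close _ px).
  move/existsPn: none => /(_ z); rewrite zp1 /=.
  by move=> /negbTE.
move=> p21 xp2 p2x; right; apply/eqP/cards1P; exists q1; apply/setP=> z.
rewrite in_setD in_set1 [z \in nbhd x]inE (mixed_close _ px).
have [->|zq1] := eqVneq z q1; first by rewrite xq1.
apply/negbTE; apply/negP=> /andP[xz pz].
have c1 : close p1 q1 by rewrite -(close_congr _ pp1).
have c2 : close p2 z.
  by move: p2x; rewrite (mixed_close _ px) => /close_congr <-.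
have [e|e] := mixed_unique c1 xp1 xq1 c2 xp2 xz.
- by rewrite e eqxx in p21.
- by rewrite e eqxx in zq1.
Qed.

(** * Counting modulo the class size *)

Section Classes.
Variable m : nat.
Hypothesis m_gt2 : 2 < m.
Hypothesis card_class : forall x, #|[set y | close x y]| = m.

Lemma dvdn_closed (S : {set G}) :
  (forall x y, close x y -> x \in S -> y \in S) -> m %| #|S|.
Proof. exact: dvdn_card_closed close_equiv card_class. Qed.

Lemma mixed_nonempty x : exists p, p \in mixed x.
Proof.
have /card_gt0P[y] : 0 < #|[set y | close x y] :\ x|.
  have := cardsD1 x [set y | close x y]; rewrite inE closexx card_class; lia.
by rewrite !inE eq_sym => /andP[/close_swap_mixed h /h].
Qed.

Lemma card_mixed x : #|mixed x| = m.
Proof.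
have [p px] := mixed_nonempty x; rewrite -(card_class p).
by apply: eq_card => q; rewrite (mixed_close _ px) inE.
Qed.

(** The neighbours of [x] outside [mixed x] form a union of classes. *)
Lemma card_nbhd_mixed_mod x : #|nbhd x :&: mixed x| = b.+1 %[mod m].
Proof.
rewrite -(regG x) -(cardsID (mixed x) (nbhd x)) -modnDmr.
have /eqP-> : m %| #|nbhd x :\: mixed x|; last by rewrite addn0.
apply: dvdn_closed => p q pq; rewrite !in_setD ![_ \in nbhd x]inE.
case/andP=> px xp; rewrite (notin_mixed px pq) xp andbT.
by apply: contra px => qx; rewrite (mixed_close _ qx) closeC.
Qed.

Lemma card_nbhd_mixed_small x :
  #|nbhd x :&: mixed x| = 1 \/ #|nbhd x :&: mixed x| = m.-1.
Proof.
have [p px] := mixed_nonempty x; have := cardsID (nbhd x) (mixed x).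
rewrite card_mixed setIC.
have /card_nbhd_mixed[->|->] : mixed x != set0 by apply/set0Pn; exists p.
  by left.
by move=> <-; right; rewrite addn1.
Qed.

Lemma coprime_degree (x : G) : coprime m b.+1.
Proof.
rewrite -coprime_modr -(card_nbhd_mixed_mod x) coprime_modr.
have [->|->] := card_nbhd_mixed_small x; first exact: coprimen1.
by rewrite -[X in coprime X](prednK (ltnW (ltnW m_gt2))) coprimeSn.
Qed.

(** The common neighbours outside [mixed u] and [mixed w] form a union of classes. Adjacency to [w]
    is constant on [mixed u], since otherwise [mixed_sym] would make [u] and [w] close; so [mixed u]
    contributes all of [nbhd u :&: mixed u] or nothing. *)
Lemma common_mod u w x y :
    ~~ close u w -> x \in mixed u -> y \in mixed w ->
  common u w = b.+1 * (adj w x + adj u y) %[mod m].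
Proof.
move=> nuw xu yw.
have part u0 w0 x0 : ~~ close u0 w0 -> x0 \in mixed u0 ->
    #|nbhd u0 :&: nbhd w0 :&: mixed u0| = b.+1 * adj w0 x0 %[mod m].
  move=> nuw0 xu0.
  have eqw z : z \in mixed u0 -> adj w0 z = adj w0 x0.
    move=> zu0; apply: notin_mixed; last by rewrite -(mixed_close _ xu0).
    apply: contra nuw0 => /mixed_sym wx0.
    by rewrite -(mixed_close _ (mixed_sym xu0)).
  case wx: (adj w0 x0); rewrite ?muln1 ?muln0.
  - rewrite -(card_nbhd_mixed_mod u0); congr (_ %% m); apply: eq_card => z.
    rewrite !in_setI ![_ \in nbhd _]inE.
    by case: (boolP (z \in _)) => [/eqw ->|]; rewrite ?andbF ?wx ?andbT.
  - rewrite (_ : _ :&: _ = set0) ?cards0 //; apply/setP=> z.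
    rewrite !in_setI ![_ \in nbhd _]inE in_set0.
    by case: (boolP (z \in _)) => [/eqw ->|]; rewrite ?andbF ?wx ?andbF.
set A := nbhd u :&: nbhd w.
have outside z : z \in mixed w -> z \notin mixed u.
  move=> zw; apply: contra nuw => zu.
  by rewrite -(mixed_close _ (mixed_sym zu)) mixed_sym.
rewrite mulnDr -modnDm -(part u w x) // -(part w u y) 1?closeC //.
rewrite modnDm /common -/A -(cardsID (mixed u) A) [nbhd w :&: _]setIC -/A.
rewrite -(cardsID (mixed w) (A :\: _)) addnA -modnDmr.
have /eqP-> : m %| #|A :\: mixed u :\: mixed w|.
  apply: dvdn_closed => p q pq; rewrite !in_setD !in_setI ![_ \in nbhd _]inE.
  have notin z : p \notin mixed z -> q \notin mixed z.
    by apply: contra => qz; rewrite (mixed_close _ qz) closeC.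
  case/and4P=> pw pu up wp.
  by rewrite !notin // (notin_mixed pu pq) (notin_mixed pw pq) up.
rewrite addn0 [(A :\: _) :&: _](_ : _ = A :&: mixed w) //.
apply/setP=> z; rewrite !(in_setI, in_setD) -andbA andbCA andbC.
by case: (boolP (z \in mixed w)) => [/outside->|]; rewrite ?andbF ?andbT.
Qed.

Hypothesis diamG : has_diameter G 2.

Lemma mixed_self u : u \in mixed u.
Proof.
have [//|nuu] := boolP (u \in mixed u).
have [p pu] := mixed_nonempty u.
have [y yu uy] : exists2 y, y \in mixed u & ~~ adj u y.
  have /mixedP[_ [y [_ py _ uy]]] := pu.
  by exists y; rewrite // (mixed_close _ pu).
have uyy := mixed_sym yu.
have nclose : ~~ close u y.
  by apply: contra nuu; rewrite (mixed_close _ yu) closeC.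
have neq : u != y by apply: contraNneq nclose => ->; rewrite closexx.
(* [y] lies in [mixed u] and [u] in [mixed y], so both adjacencies in [common_mod] are loops. *)
have a0 : m %| a.
  have := common_mod nclose yu uyy; rewrite !adj_irr muln0 mod0n => /eqP.
  by have [e|->//] := dezG neq; rewrite /close e eqxx orbT in nclose.
(* Otherwise [m] divides [adj y w + adj u z], which is 1 or 2 and less than [m]. *)
have far w : adj y w -> close u w.
  apply: contraLR => nuw; have [z zw] := mixed_nonempty w.
  have := common_mod nuw yu zw.
  have uw : u != w by apply: contraNneq nuw => ->; rewrite closexx.
  have -> : common u w = a.
    by have [e|//] := dezG uw; rewrite /close e eqxx orbT in nuw.
  rewrite (eqP a0) => /esym/eqP; rewrite -/(dvdn _ _) Gauss_dvdr.
    rewrite adj_sym; case: (adj y w); case: (adj u z) => //=;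
    by move=> /dvdn_leq => /(_ isT); lia.
  exact: coprime_degree.
have [z uz zy] := diameter2_common diamG neq uy.
have := notin_mixed nuu (far z _); rewrite adj_sym zy uz adj_irr.
by move/(_ isT).
Qed.

Lemma close_or_adj :
  (forall u w, ~~ close u w -> adj u w) \/ (forall u w, close u w).
Proof.
have cong u w : ~~ close u w -> a = b.+1 * (2 * adj u w) %[mod m].
  move=> nuw; have uw : u != w by apply: contraNneq nuw => ->; rewrite closexx.
  have := common_mod nuw (mixed_self u) (mixed_self w).
  rewrite [adj w u]adj_sym addnn -mul2n => <-.
  by have [e|->//] := dezG uw; rewrite /close e eqxx orbT in nuw.
(* If [m] divides [a], adjacent vertices are close and diameter 2 leaves a single class; if not,
   distinct classes are completely joined. *)
have [a0|a0] := boolP (m %| a); [right => u w | left => u w nuw]; last first.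
  apply: contraR a0 => /negbTE nadj.
  by rewrite /dvdn (cong _ _ nuw) nadj !muln0 mod0n.
have adj_close x y : adj x y -> close x y.
  move=> xy; apply: contraT => /cong; rewrite xy (eqP a0) => /esym/eqP.
  rewrite -/(dvdn _ _) Gauss_dvdr ?coprime_degree // => /dvdn_leq; lia.
have [->|uw] := eqVneq u w; first exact: closexx.
have [/adj_close//|nuw] := boolP (adj u w).
have [z /adj_close uz /adj_close zw] := diameter2_common diamG uw nuw.
exact: close_trans uz zw.
Qed.

End Classes.
End Gap.
End Swaps.

(** * Coordinates and the isomorphism *)

Lemma enum_classes (T : finType) (R : rel T) (D : {set T}) s (x0 : T) :
    {in D & &, equivalence_rel R} ->
    {in D, forall x, #|[set y in D | R x y]| = s} ->
  exists t (h : 'I_t * 'I_s -> T),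
    [/\ #|D| = t * s, injective h, forall i, h i \in D &
        forall i j, R (h i) (h j) = (i.1 == j.1)].
Proof.
move=> eqR cardR; set P := equivalence_partition R D.
have partP : partition P D := equivalence_partitionP eqR.
have /and3P[/eqP coverP trivP _] := partP.
have cardP A : A \in P -> #|A| = s by case/imsetP=> x /cardR <- ->.
(* By [sizeh] the default [x0] is never reached. *)
pose h (i : 'I_#|P| * 'I_s) : T := nth x0 (enum (enum_val i.1)) i.2.
have sizeh (i : 'I_#|P| * 'I_s) : i.2 < size (enum (enum_val i.1)).
  by rewrite -cardE cardP ?enum_valP.
have h_block i : h i \in enum_val i.1 by rewrite -mem_enum mem_nth.
have hD i : h i \in D.
  by rewrite -coverP; apply/bigcupP; exists (enum_val i.1); rewrite ?enum_valP.
have hR i j : R (h i) (h j) = (i.1 == j.1).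
  rewrite -(pblock_equivalence_partition eqR) // -/P.
  rewrite -eq_pblock ?coverP //.
  rewrite !(def_pblock trivP (enum_valP _) (h_block _)).
  by rewrite (inj_eq enum_val_inj).
exists #|P|, h; split=> //; first exact: card_uniform_partition partP.
move=> [i1 i2] [j1 j2] eqh.
have /eqP/= e1 : (i1, i2).1 == (j1, j2).1.
  rewrite -hR eqh; exact: (eqR _ _ _ (hD _) (hD _) (hD _)).1.
move: (sizeh (i1, i2)) (sizeh (j1, j2)) eqh; rewrite /h /= -{}e1 => si sj /eqP.
by rewrite nth_uniq ?enum_uniq // => /eqP/val_inj->.
Qed.

(* A set of representatives of the pairs [{u, mate u}] is enumerated by
   [enum_classes]; the coordinate in ['I_2] tells a representative from its
   mate. *)
Lemma iso_clique_extension_multipartite (G : sgraph) (R : rel G) m (x0 : G) :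
    equivalence_rel R -> (forall u, #|[set w | R u w]| = m) ->
    (forall u w, ~~ R u w -> adj u w) ->
    (forall u, #|[set w | R u w && adj u w]| = 1) ->
  exists t s, [/\ #|G| = t * m, 2 * s = m &
    isomorphic G (clique_extension 2 (complete_multipartite t s))].
Proof.
move=> eqR cardR nonR card1.
have Rxx x : R x x by have [] := eqR x x x.
have Rcongr x y z : R x y -> R x z = R y z by have [_] := eqR x y z; apply.
have Rsym x y : R x y = R y x.
  by apply/idP/idP=> /[dup] /Rcongr <-.
have [mate mateP] : exists mate : G -> G,
    forall u w, R u w && adj u w = (w == mate u).
  exists (fun u => odflt u [pick w in [set w | R u w && adj u w]]) => u w.
  have /eqP/cards1P[w0 e] := card1 u.
  have := in_set1 w w0; rewrite -e inE => ->; rewrite e.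
  case: pickP => [w1|/(_ w0)]; first by rewrite inE => /eqP->.
  by rewrite !inE eqxx.
have [R_mate adj_mate] : (forall u, R u (mate u)) /\ (forall u, adj u (mate u)).
  by split=> u; have := mateP u (mate u); rewrite eqxx => /andP[].
have mateK : involutive mate.
  move=> u; apply/esym/eqP; rewrite -mateP Rsym R_mate adj_sym.
  exact: adj_mate.
have mate_neq u : u != mate u.
  by apply: contraTneq (adj_mate u) => <-; rewrite adj_irr.
pose D := [set u | enum_rank u < enum_rank (mate u)].
have mateD u : (mate u \in D) = (u \notin D).
  rewrite !inE mateK -leqNgt ltn_neqAle andb_idl // => _; apply/eqP=> e.
  by have := mate_neq u; rewrite (enum_rank_inj (val_inj e)) eqxx.
(* [mate] maps [A :&: D] bijectively onto [A :\: D]. *)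
have double (A : {set G}) : (forall u, (mate u \in A) = (u \in A)) ->
    2 * #|A :&: D| = #|A|.
  move=> Amate; rewrite -(cardsID D A) mul2n -addnn; congr (_ + _).
  rewrite -(card_imset _ (can_inj mateK)); apply: eq_card => u.
  rewrite in_setD -(mateD u) -{1}[u]mateK (mem_imset _ _ (can_inj mateK)).
  by rewrite in_setI Amate andbC.
have Rmate u w : R u (mate w) = R u w.
  by rewrite Rsym -(Rcongr w) ?R_mate // Rsym.
have Rmatel u w : R (mate u) w = R u w by rewrite Rsym Rmate Rsym.
have cardD u : 2 * #|[set w in D | R u w]| = m.
  rewrite -(cardR u) -(double [set w | R u w]) => [|w]; last first.
    by rewrite !inE Rmate.
  by congr (2 * _); apply: eq_card => w; rewrite !inE andbC.
have eqRD : {in D & &, equivalence_rel R} by move=> x y z _ _ _.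
have [|t [h [cardDE h_inj hD hR]]] := @enum_classes _ R D m./2 x0 eqRD.
  by move=> u _; have := cardD u; lia.
have em : 2 * m./2 = m by have := cardD x0; lia.
have cardG : #|G| = t * m.
  have := double setT; rewrite setTI cardsT cardDE => <- => [|u]; last first.
    by rewrite !inE.
  by rewrite mulnCA em.
exists t, m./2; split=> //.
pose f (i : 'I_t * 'I_(m./2) * 'I_2) : G :=
  if i.2 == ord0 then h i.1 else mate (h i.1).
have ord2 (e : 'I_2) : (e == ord0) = false -> e = ord_max.
  by case: e => [[|[|//]] ?] // _; apply: val_inj.
have hne p q : (h p == mate (h q)) = false.
  by apply: contraTF (hD p) => /eqP->; rewrite mateD negbK.
have f_adj i j : adj (f i) (f j) = ext_adj (D1 := complete_multipartite t m./2)
    (D2 := complete_graph 2) i j.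
  have RE : R (f i) (f j) = (i.1.1 == j.1.1).
    by rewrite -hR /f; do 2!case: eqP => _; rewrite ?Rmate ?Rmatel.
  rewrite /ext_adj /= /multipartite_adj /= /complete_adj /= -RE.
  have [Rij|/nonR->//] := boolP (R (f i) (f j)); rewrite /=.
  have -> : adj (f i) (f j) = (f j == mate (f i)) by rewrite -mateP Rij.
  case: i j {RE Rij} => [p e] [q e']; rewrite /f /=.
  case ee: (e == ord0); case ee': (e' == ord0).
  - by rewrite hne (eqP ee) (eqP ee') eqxx andbF.
  - by rewrite (inj_eq (can_inj mateK)) (inj_eq h_inj) (eqP ee) eq_sym
      [ord0 == _]eq_sym ee' andbT.
  - by rewrite mateK (inj_eq h_inj) (eqP ee') ee eq_sym andbT.
  - by rewrite mateK eq_sym hne (ord2 _ ee) (ord2 _ ee') eqxx andbF.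
have f_inj : injective f.
  move=> [p e] [q e']; rewrite /f /=.
  case ee: (e == ord0); case ee': (e' == ord0).
  - by move/h_inj->; rewrite (eqP ee) (eqP ee').
  - by move/eqP; rewrite hne.
  - by move/esym/eqP; rewrite hne.
  - by move/(can_inj mateK)/h_inj->; rewrite (ord2 _ ee) (ord2 _ ee').
have [|g fK gK] := inj_card_bij f_inj.
  by rewrite !card_prod !card_ord cardG -mulnA [_ * 2]mulnC em.
exists g; split; first by exists f.
by move=> x y; rewrite -{2}[x]gK -{2}[y]gK f_adj.
Qed.

(** * Excluding a = b - 1 *)

Lemma no_small_gap (G : sgraph) n b a :
    strictly_deza G n b.+1 b a -> 1 < beta G b -> a.+1 < b.
Proof.
move=> sG; have ltab := strictly_deza_lt sG; have cardB := card_Bset _ sG.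
case: sG => -[[nG n_gt0] regG _ dezG] diamG nsrg beta_gt1.
rewrite ltn_neqAle ltab andbT; apply/eqP=> eb; subst b.
have count (v : G) : a.+2 * a.+2 = a.+2 + #|Bset a.+1 v| + a * n.-1.
  have vB : v \notin Bset a.+1 v by rewrite inE /common setIid regG; lia.
  have cB : #|Bset a.+1 v| = \sum_(u | u != v) (common v u == a.+1).
    rewrite -sum1_card big_mkcond (bigD1 v) //= (negbTE vB) add0n.
    by apply: eq_bigr => u _; rewrite inE; case: eqP.
  have cA : a * n.-1 = \sum_(u | u != v) a.
    rewrite sum_nat_cond_const -nG -(cardC1 v) mulnC; congr (_ * _).
    by apply: eq_card => u; rewrite !inE.
  rewrite -(sum_common v regG) (bigD1 v) //= {1}/common setIid regG -addnA.
  rewrite cB cA -big_split /=; congr (_ + _); apply: eq_bigr => u uv.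
  have /dezG : v != u by rewrite eq_sym.
  by case=> ->; rewrite ?eqxx ?add1n //; case: eqP; lia.
have [u [v [uv nuv]]] := diameter2_nonadj diamG.
have cuv (x y : G) : x != y -> ~~ adj x y -> 0 < common x y.
  move=> xy nxy; have [z xz zy] := diameter2_common diamG xy nxy.
  by apply/card_gt0P; exists z; rewrite !inE xz adj_sym.
have nonnbr (x : G) : #|~: (x |: nbhd x)| = n - a.+3.
  by rewrite cardsCs setCK cardsU1 inE adj_irr regG nG.
(* If n = k + 2, then [u] and [v] have the same neighbourhood, hence k common neighbours, which is
   neither [a] nor [b]. *)
have n_gt : a.+4 < n.
  have c2 : #|~: [set u; v]| = n - 2 by rewrite cardsCs setCK cards2 uv nG.
  have := subset_leq_card (nbhd_subset_nonadj nuv); rewrite regG c2 => le.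
  rewrite ltnNge; apply/negP=> ge.
  have nvu : ~~ adj v u by rewrite adj_sym.
  have Nu : nbhd u = ~: [set u; v].
    by apply/eqP; rewrite eqEcard nbhd_subset_nonadj // regG c2; lia.
  have Nv : nbhd v = ~: [set u; v].
    by apply/eqP; rewrite eqEcard setUC nbhd_subset_nonadj // regG setUC c2;
       lia.
  have := dezG _ _ uv; rewrite /common Nu -Nv setIid regG; lia.
have a0 : a = 0.
  have := count u; rewrite (cardB u); move: beta_gt1 n_gt.
  case: (a) => // c; nia.
(* Now k = 2, and [count] gives [Bset 1 x] two elements. The non-neighbours of [x], at least two in
   number, all lie in it, so they fill it and adjacent vertices have no common neighbour: the graph
   is a pentagon. *)
subst a; apply: nsrg; exists n, 2, 0, 1; split=> // [x y xy|x y xy nxy];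
  last first.
  by have := cuv _ _ xy nxy; have [->|->] := dezG _ _ xy.
have sub : ~: (x |: nbhd x) \subset Bset 1 x.
  apply/subsetP=> z; rewrite !inE negb_or => /andP[zx nxz].
  have xz : x != z by rewrite eq_sym.
  by have := cuv _ _ xz nxz; have [->|->] := dezG _ _ xz.
have eqB : ~: (x |: nbhd x) = Bset 1 x.
  apply/eqP; rewrite eqEcard sub nonnbr; have := count x; lia.
have nxy : x != y by apply: contraTneq xy => ->; rewrite adj_irr.
have : y \notin ~: (x |: nbhd x) by rewrite !inE xy orbT.
rewrite eqB inE; by have [->|] := dezG _ _ nxy.
Qed.

(** * From k = b + 1 to the clique extension *)

Lemma deza_clique_extension (G : sgraph) n b a :
    strictly_deza G n b.+1 b a -> 1 < beta G b ->
  exists t s, [/\ 1 < t, 2 * s = n - b.+1 + 1 &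
    isomorphic G (clique_extension 2 (complete_multipartite t s))].
Proof.
move=> sG beta_gt1; have gap := no_small_gap sG beta_gt1.
have cardB := card_Bset _ sG.
case: sG => -[[nG n_gt0] regG _ dezG] diamG nsrg.
pose R := @close G b; pose m := (beta G b).+1.
have cardR (u : G) : #|[set w | R u w]| = m.
  rewrite /m -(cardB u) -[RHS]add1n.
  have -> : 1 = (u \notin Bset b u).
    by rewrite inE /common setIid regG; case: eqP => //; lia.
  rewrite -cardsU1; apply: eq_card => w.
  by rewrite !inE /R /close [w == u]eq_sym.
have eqR : equivalence_rel R := close_equiv regG gap dezG.
have m_gt2 : 2 < m by [].
have [nonR|allR] := close_or_adj regG gap dezG m_gt2 cardR diamG; last first.
  case: nsrg; exists n, b.+1, b, b; split=> // u v => [uv|uv _].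
    have := allR u v; rewrite /close; case: eqP => [e|_ /eqP//].
    by rewrite e adj_irr in uv.
  by have := allR u v; rewrite /close (negbTE uv) => /eqP.
(* Every vertex outside the class of [u] is a neighbour of [u]. *)
have card_nonR (u : G) : #|[set w | R u w && adj u w]| + (n - m) = b.+1.
  rewrite -(regG u) -(cardsID [set w | R u w] (nbhd u)); congr (_ + _).
    by apply: eq_card => w; rewrite !inE andbC.
  rewrite -nG -(cardR u) -[in LHS](setCK [set w | R u w]) -cardsCs.
  apply: eq_card => w.
  rewrite !inE; case Rw: (R u w) => //=; apply/esym/nonR.
  exact: negbT Rw.
have /card_gt0P[x0 _] : 0 < #|G| by rewrite nG.
have le_mn : m <= n by rewrite -nG -(cardR x0) max_card.
have card1 (u : G) : #|[set w | R u w && adj u w]| = 1.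
  have self := mixed_self regG gap dezG m_gt2 cardR diamG u.
  have mixedE : mixed b u = [set w | R u w].
    by apply/setP=> w; rewrite (mixed_close regG gap dezG _ self) inE.
  have /(card_nbhd_mixed regG gap dezG) : mixed b u != set0.
    by apply/set0Pn; exists u.
  rewrite mixedE => -[e|e].
    by rewrite -[RHS]e; apply: eq_card => w; rewrite !inE andbC.
  (* Otherwise the degree is [n - 1]. *)
  have := cardsID (nbhd u) [set w | R u w]; rewrite e cardR setIC.
  have := card_nonR u; have [x [y [xy nxy]]] := diameter2_nonadj diamG.
  have := subset_leq_card (nbhd_subset_nonadj nxy); rewrite regG.
  rewrite cardsCs setCK cards2 xy nG.
  rewrite [nbhd u :&: _](_ : _ = [set w | R u w && adj u w]); first lia.
  by apply/setP=> w; rewrite !inE andbC.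
have [t [s [cardG em iso]]] :=
  iso_clique_extension_multipartite x0 eqR cardR nonR card1.
exists t, s; split=> //; last first.
  by rewrite em; have := card_nonR x0; rewrite card1; lia.
(* A single part would give n = m, hence degree 1 and b = 0. *)
case: t cardG {iso} => [|[|//]]; rewrite nG; first lia.
have := card_nonR x0; rewrite card1; lia.
Qed.

(** * Twins and the converse *)

(** The twin is the other vertex of the same copy of the 2-clique; [rev_ord] exchanges the two
    elements of ['I_2]. *)
Lemma isomorphic_twins (G D : sgraph) (f : G -> clique_extension 2 D) :
    bijective f -> (forall x y : G, adj (f x) (f y) = adj x y) ->
  forall x : G, exists2 y, adj x y &
    forall z, z != x -> z != y -> adj x z = adj y z.
Proof.
case=> g fK gK f_adj x; exists (g ((f x).1, rev_ord (f x).2)).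
  rewrite -f_adj gK /= /ext_adj /= eqxx orbC /complete_adj /=.
  by case: (f x).2 => [[|[|]]].
move=> z zx; rewrite -(can_eq fK) gK => zy; rewrite -!f_adj gK.
move: zx zy; rewrite -(can_eq fK).
case: (f z) (f x) => [z1 z2] [x1 x2] /=; rewrite /ext_adj /=.
case: (x1 =P z1) => [->|//] zx zy; rewrite adj_irr /complete_adj /=.
move: zx zy; rewrite !xpair_eqE eqxx /=.
by case: z2 x2 => [[|[|]] ?] // [[|[|]] ?].
Qed.

Lemma twins_deza (G : sgraph) n k b a :
    deza G n k b a -> (exists u v : G, u != v /\ common u v = b) ->
    (forall x : G, exists2 y, adj x y &
       forall z, z != x -> z != y -> adj x z = adj y z) ->
  k = b + 1.
Proof.
case=> _ regG leab dezG [u [v [uv cuv]]] twin.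
have le (x y : G) : common x y <= k.
  by rewrite -(regG x) subset_leq_card ?subsetIl.
have [w uw wtwin] := twin u.
have nuw : u != w by apply: contraTneq uw => ->; rewrite adj_irr.
have cuw : k = (common u w).+1.
  rewrite -(regG u) (cardsD1 w) inE uw; congr (_.+1); apply: eq_card => z.
  rewrite !inE; have [->|zw] /= := eqVneq z w; first by rewrite adj_irr andbF.
  have [->|zu] := eqVneq z u; first by rewrite adj_irr.
  by rewrite -wtwin // andbb.
(* If b = k, then [u] and [v] have the same neighbourhood, so [v] is adjacent to the twin [w] of [u]
   but not to [u], a contradiction. *)
have lt_bk : b < k.
  rewrite -cuv ltn_neqAle le andbT; apply/eqP=> cuvk.
  have Nu : nbhd u :&: nbhd v = nbhd u.
    by apply/eqP; rewrite eqEcard subsetIl regG -cuvk /=.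
  have Nv : nbhd u :&: nbhd v = nbhd v.
    by apply/eqP; rewrite eqEcard subsetIr regG -cuvk /=.
  have nuv (z : G) : adj u z = adj v z.
    by have := congr1 (fun A : {set G} => z \in A) Nu; rewrite Nv !inE.
  have vw : v != w by apply: contraTneq uw => <-; rewrite nuv adj_irr.
  have vu : v != u by rewrite eq_sym.
  by have := wtwin v vu vw; rewrite nuv adj_irr adj_sym -nuv uw.
by have := dezG _ _ nuw; lia.
Qed.

Theorem theorem1 (G : sgraph) (n k b a : nat)
    (hG : strictly_deza G n k b a) (hbeta : 1 < beta G b) :
  k = b + 1 <->
  exists t s : nat,
    [/\ 1 < t, 2 * s = n - k + 1 &
        isomorphic G (clique_extension 2 (complete_multipartite t s))].
Proof.
split=> [ek|[t [s [_ _ [f [bijf f_adj]]]]]].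
  by move: hG; rewrite ek addn1 => hG; apply: deza_clique_extension hG hbeta.
have [dezG _ _] := hG.
apply: (twins_deza dezG); last exact: isomorphic_twins bijf f_adj.
have /card_gt0P[u _] : 0 < #|G| by case: dezG => -[->].
(* As beta is at least 2, [Bset b u] contains a vertex other than [u]. *)
have /card_gt0P[v] : 0 < #|Bset b u :\ u|.
  have := cardsD1 u (Bset b u); rewrite (card_Bset u hG).
  by case: (_ \in _) => /=; lia.
by rewrite !inE eq_sym => /andP[uv /eqP]; exists u, v.
Qed.
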